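(* Let $P=[m]=\{1<2<\cdots<m\}$, i.e. $P$ is a chain of length $m-1$. If $m\ge3$ and $n\ge3$, then $\mathrm{HS}_2(\mathcal{L}(P,n))$ does not admit a linear resolution.
   Context: $[n]=\{1,\ldots,n\}$, $\mathbf{K}$ is a field, $R=\mathbf{K}[X_{p,i}\mid p\in P,\ i\in[n]]$. $\mathrm{Hom}(P,n)$ is the set of maps $f:P\to[n]$ that are isotone ($p\le q$ implies $f(p)\le f(q)$), $U_f:=\prod_{p\in P}X_{p,f(p)}$, and $\mathcal{L}(P,n):=(U_f\mid f\in\mathrm{Hom}(P,n))\subseteq R$. Homological shift ideals: if a monomial ideal $I\subseteq R$ has minimal multigraded free resolution $0\to F_p\to\cdots\to F_0\to I\to0$ with $F_t=\bigoplus_{j=1}^{\beta_t(I)}R(-\mathbf{a}_{t,j})$, then $\mathrm{HS}_t(I):=(X^{\mathbf{a}_{t,j}}\mid j=1,\ldots,\beta_t(I))$ (which is $(0)$ for $t>p=\mathrm{pd}(I)$). *)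

(* Defs.v *)
From mathcomp Require Import all_boot all_order all_algebra.
From mathcomp Require Import mpoly.

Set Implicit Arguments.
Unset Strict Implicit.
Unset Printing Implicit Defensive.

Import Order.TTheory GRing.Theory.
Local Open Scope ring_scope.

(* An ideal is represented by its membership predicate. *)
Definition ideal_gen (A : comNzRingType) (G : A -> Prop) (x : A) : Prop :=
  exists2 s : seq (A * A),
    {in s, forall c, G c.2} & x = \sum_(c <- s) c.1 * c.2.

(* Data of a sequence ... -> F_1 -> F_0 -> A of finitely generated free modules
   with chosen bases.  Elements of F_t are row vectors, maps act by right
   multiplication: fc_diff t is the matrix of F_(t+1) -> F_t and fc_aug that
   of F_0 -> A. *)
Record free_complex (A : comNzRingType) := FreeComplex {
  fc_rank : nat -> nat;
  fc_diff : forall t, 'M[A]_(fc_rank t.+1, fc_rank t);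
  fc_aug : 'cV[A]_(fc_rank 0)
}.

Section Resolutions.
Variables (K : fieldType) (N : nat).
Local Notation R := {mpoly K[N]}.
Implicit Types (F : free_complex R) (I : R -> Prop).

(* 0 -> F_p -> ... -> F_0 -> I -> 0 is exact, for some p. *)
Definition is_free_resolution F I : Prop :=
  [/\ exists p : nat, forall t, (p < t)%N -> fc_rank F t = 0%N,
      forall x : R, I x <->
        exists v : 'rV_(fc_rank F 0), v *m fc_aug F = x%:M,
      forall v : 'rV_(fc_rank F 0), v *m fc_aug F = 0 <->
        exists w, v = w *m fc_diff F 0
    & forall t (v : 'rV_(fc_rank F t.+1)), v *m fc_diff F t = 0 <->
        exists w, v = w *m fc_diff F t.+1].

(* The image of F_(t+1) lies in (X_1, ..., X_N) F_t. *)
Definition is_minimal F : Prop :=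
  forall t i j, (fc_diff F t i j)@_0%MM = 0.

(* F_t = \bigoplus_j R(-a t j), and all maps preserve the N^N-grading. *)
Definition is_multigraded F
    (a : forall t, 'I_(fc_rank F t) -> 'X_{1..N}) : Prop :=
  (forall i, {in msupp (fc_aug F i ord0), forall u, u = a 0%N i}) /\
  (forall t i j,
     {in msupp (fc_diff F t i j), forall u, (u + a t j)%MM = a t.+1 i}).

(* F_t = \bigoplus_j R(-b t j), and all maps preserve the standard grading. *)
Definition is_graded F (b : forall t, 'I_(fc_rank F t) -> nat) : Prop :=
  (forall i, {in msupp (fc_aug F i ord0), forall u, mdeg u = b 0%N i}) /\
  (forall t i j,
     {in msupp (fc_diff F t i j), forall u, (mdeg u + b t j)%N = b t.+1 i}).

Definition is_min_multigraded_resolution F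
    (a : forall t, 'I_(fc_rank F t) -> 'X_{1..N}) I : Prop :=
  [/\ is_free_resolution F I, is_minimal F & is_multigraded a].

Definition is_min_graded_resolution F
    (b : forall t, 'I_(fc_rank F t) -> nat) I : Prop :=
  [/\ is_free_resolution F I, is_minimal F & is_graded b].

(* F_t = R(-(d + t))^(beta_t) for all t, where d is the generating degree. *)
Definition has_linear_resolution I : Prop :=
  exists (d : nat) (F : free_complex R),
    is_min_graded_resolution (F := F) (fun t _ => (d + t)%N) I.

(* HS_t(I), read off from the multigraded shifts a of a minimal multigraded
   free resolution F of I; it does not depend on the choice of F. *)
Definition HS F (a : forall t, 'I_(fc_rank F t) -> 'X_{1..N}) (t : nat) :
    R -> Prop :=
  ideal_gen (fun x : R => exists j, x = 'X_[a t j]).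

End Resolutions.

Section LetterplaceIdeals.
Variables (K : fieldType) (d : Order.disp_t) (P : finPOrderType d) (n : nat).

(* [n] is 'I_n = {0, ..., n-1}, and the variables X_{p,i} are numbered by
   enumerating the finite type P * 'I_n. *)
Definition nvars : nat := #|{: P * 'I_n}|.

Definition Xvar (p : P) (i : 'I_n) : {mpoly K[nvars]} := 'X_(enum_rank (p, i)).

Definition isotone (f : P -> 'I_n) : Prop :=
  {homo f : p q / (p <= q)%O >-> (p <= q)%O}.

Definition Umon (f : P -> 'I_n) : {mpoly K[nvars]} :=
  \prod_(p : P) Xvar p (f p).

Definition Lideal : {mpoly K[nvars]} -> Prop :=
  ideal_gen (fun x => exists2 f : P -> 'I_n, isotone f & x = Umon f).

End LetterplaceIdeals.

Arguments Xvar K {d P n} p i.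
Arguments Umon K {d P n} f.
Arguments Lideal K {d} P n _.

(* Main.v *)
Require Import Defs.
From mathcomp Require Import all_boot all_order all_algebra.
From mathcomp Require Import mpoly zify.

(** Index rows by p in [m] and columns by i in [n], both starting at 0, so that
    U_f is the product of the cells on the graph of f.  The multidegrees of
    degree m + 2 in homological degree 2 that are supported in the first three
    columns look like lattice paths in this part of the grid.  Among them are
    the two extreme paths: u, which runs along column 0 and then turns right
    in the last row, and v, which goes right in row 0 and then runs along
    column 2.

    An ideal J with a linear resolution, generated by monomials of degree at
    least D, satisfies a linkage property ([linear_resolution_linkage]): if u
    and v are distinct monomials of degree D in J, there is a generator of
    degree D other than u that divides u * X_k for some k with u_k < v_k; that
    is, one can start walking from u to v, inside lcm(u, v), by exchanging a
    single variable.  For the two paths above this fails: within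
    these columns, the only cell of u that can be exchanged is its corner, and
    the exchange moves it to column 1 of the penultimate row, a cell outside
    both paths as m is at least 3.

    What has to be shown is therefore that u and v are shifts of F_2
    ([shift_triangle]), and that no other shift of F_2 of degree m + 2 divides
    u * X_k ([shift_near_hook]).  Both are statements on the linear strand of
    an arbitrary minimal multigraded resolution F of an ideal whose monomials
    have degree at least m.  Every entry of a matrix of F is a scalar times a
    monomial prescribed by the shifts; keeping only the scalars ([frame]) turns
    F into complexes of K-vector spaces, one for each monomial g, spanned by
    the basis elements whose shift divides g, and these are exact
    ([frame_exact]).  By minimality the differential strictly raises shifts,
    so shifts in homological degree t have degree at least m + t
    ([shift_deg]), and in degree m + t there is no room for boundaries.

    A shift y of F_2 of degree m + 2 then amounts to a cycle in the graph on
    the variables whose edges {p, q} are those with X^y / (X_p X_q) in the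
    ideal: a triangle yields a shift ([shift_triangle]), and a shift yields a
    subgraph without leaves ([shift_cycle]).  Near u the graphs consist of
    a star and at most one further edge, one end of which lies on no other
    edge; so they have no cycle. *)

Set Implicit Arguments.
Unset Strict Implicit.
Unset Printing Implicit Defensive.

Import Order.TTheory GRing.Theory.
Local Open Scope ring_scope.

(** * Monomials and monomial ideals *)

Section Monomials.
Variables (K : fieldType) (N : nat).
Local Notation R := {mpoly K[N]}.
Implicit Types x y g : 'X_{1..N}.

Lemma mcoeffMX_sub (p : R) x y :
  (p * 'X_[x])@_y = if (x <= y)%MM then p@_(y - x) else 0.
Proof.
case: ifPn => [le_xy|].
  by rewrite -{1}(submK le_xy) addmC mcoeffMX.
apply: contraNeq; rewrite -mcoeff_msupp (perm_mem (msuppMX _ _)).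
by case/mapP=> z _ ->; apply: lem_addr.
Qed.

Lemma addmAC x y g : (x + y + g = x + g + y)%MM.
Proof. by rewrite -!addmA [(y + g)%MM]addmC. Qed.

Lemma lem_mdeg x y : (x <= y)%MM -> (mdeg x <= mdeg y)%N.
Proof. by move=> le_xy; rewrite -(submK le_xy) mdegD leq_addl. Qed.

Lemma lem_mdeg_eq x y : (x <= y)%MM -> (mdeg y <= mdeg x)%N -> x = y.
Proof.
move=> le_xy; rewrite -{1 2}(submK le_xy) mdegD -{2}[mdeg x]add0n leq_add2r.
by rewrite leqn0 mdeg_eq0 => /eqP ->; rewrite add0m.
Qed.

Lemma lem_cover x y : (x <= y)%MM -> mdeg y = (mdeg x).+1 ->
  exists k, y = (x + U_(k))%MM.
Proof.
move=> le_xy dy; have: mdeg (y - x) == 1%N.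
  by rewrite -(eqn_add2r (mdeg x)) -mdegD submK // dy.
by case/mdeg1P=> k /eqP dk; exists k; rewrite addmC -dk submK.
Qed.

(** The greatest common divisor of x * X_k and x * X_l is x. *)
Lemma lem_meet g x k l : k != l ->
  (g <= x + U_(k))%MM -> (g <= x + U_(l))%MM -> (g <= x)%MM.
Proof.
move=> ne_kl /mnm_lepP le_k /mnm_lepP le_l; apply/mnm_lepP=> i.
move: (le_k i) (le_l i); rewrite !mnmDE !mnm1E.
have [<- _|_] := eqVneq k i; last by rewrite addn0.
by rewrite eq_sym (negPf ne_kl) addn0.
Qed.

Lemma ideal_gen_msupp (G : R -> Prop) (B : 'X_{1..N} -> Prop) p y :
    (forall q, G q -> exists2 b, B b & q = 'X_[b]) ->
  ideal_gen G p -> y \in msupp p -> exists2 b, B b & (b <= y)%MM.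
Proof.
move=> GB [s sG ->] /msupp_sum_le /flattenP[_ /mapP[c cs ->]].
rewrite mem_filter /= in cs; have [b Bb ->] := GB _ (sG _ cs).
rewrite (perm_mem (msuppMX _ _)) => /mapP[z _ ->].
by exists b => //; apply: lem_addr.
Qed.

Lemma ideal_gen_mulX (G : R -> Prop) b y :
  G 'X_[b] -> (b <= y)%MM -> ideal_gen G 'X_[y].
Proof.
move=> Gb le_by; exists [:: ('X_[y - b], 'X_[b])].
  by move=> c; rewrite inE => /eqP ->.
by rewrite big_seq1 /= -mpolyXD submK.
Qed.

End Monomials.

(** * Homogeneous matrices and their scalar parts *)

Section Frames.
Variables (K : fieldType) (N : nat).
Local Notation R := {mpoly K[N]}.
Local Notation mon := 'X_{1..N}.
Implicit Types g : mon.

Definition homogeneous p q (M : 'M[R]_(p, q)) (al : 'I_p -> mon)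
    (be : 'I_q -> mon) : Prop :=
  forall i j, {in msupp (M i j), forall u, (u + be j)%MM = al i}.

(** A homogeneous matrix is determined by its scalar part: the entry (i, j) is
    a multiple of the monomial al i - be j. *)
Definition frame p q (M : 'M[R]_(p, q)) (al : 'I_p -> mon)
    (be : 'I_q -> mon) : 'M[K]_(p, q) :=
  \matrix_(i, j) (M i j)@_(al i - be j).

(** Coefficient vectors of the elements of multidegree g in the free module
    with shifts al. *)
Definition below p (al : 'I_p -> mon) g (v : 'rV[K]_p) : Prop :=
  forall i, v 0 i != 0 -> (al i <= g)%MM.

Definition homogenize p (al : 'I_p -> mon) g (v : 'rV[K]_p) : 'rV[R]_p :=
  \row_i (v 0 i *: 'X_[g - al i]).

Definition component p (al : 'I_p -> mon) g (w : 'rV[R]_p) : 'rV[K]_p :=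
  \row_i (if (al i <= g)%MM then (w 0 i)@_(g - al i) else 0).

Lemma frame_neq0 p q (M : 'M_(p, q)) al be i j : homogeneous M al be ->
  frame M al be i j != 0 -> (be j <= al i)%MM.
Proof.
by rewrite mxE -mcoeff_msupp => hM /hM <-; apply: lem_addl.
Qed.

Lemma homogeneous_frame p q (M : 'M_(p, q)) al be i j : homogeneous M al be ->
  M i j = frame M al be i j *: 'X_[al i - be j].
Proof.
move=> hM; apply/mpolyP=> u; rewrite mxE mcoeffZ mcoeffX.
have [<-|ne_u] := eqVneq; first by rewrite mulr1.
rewrite mulr0; apply: contraNeq ne_u; rewrite -mcoeff_msupp => /hM <-.
by rewrite addmK.
Qed.

Lemma below_le p (al : 'I_p -> mon) g g' v :
  (g <= g')%MM -> below al g v -> below al g' v.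
Proof. by move=> le_g v_g i /v_g /lepm_trans; apply. Qed.

Lemma belowD p (al : 'I_p -> mon) g v w :
  below al g v -> below al g w -> below al g (v + w).
Proof.
move=> v_g w_g i; rewrite mxE; have [->|/v_g //] := eqVneq (v 0 i) 0.
by rewrite add0r => /w_g.
Qed.

Lemma belowN p (al : 'I_p -> mon) g v : below al g v -> below al g (- v).
Proof. by move=> v_g i; rewrite mxE oppr_eq0 => /v_g. Qed.

Lemma below_delta p (al : 'I_p -> mon) i : below al (al i) (delta_mx 0 i).
Proof.
move=> k; rewrite mxE eqxx /=.
by have [-> _|_] := eqVneq k i; rewrite ?lepm_refl ?eqxx.
Qed.

Lemma component_below p (al : 'I_p -> mon) g w : below al g (component al g w).
Proof. by move=> i; rewrite mxE; case: ifP; rewrite ?eqxx. Qed.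

Lemma homogenizeK p (al : 'I_p -> mon) g v :
  below al g v -> component al g (homogenize al g v) = v.
Proof.
move=> v_g; apply/rowP=> i; rewrite !mxE mcoeffZ mcoeffX eqxx mulr1.
by case: ifPn => // /negP h; apply/esym/eqP; apply: contra_notT h => /v_g.
Qed.

Lemma homogenize_mul p q (M : 'M_(p, q)) al be g v :
    homogeneous M al be -> below al g v ->
  homogenize al g v *m M = homogenize be g (v *m frame M al be).
Proof.
move=> hM v_g; apply/rowP=> j; rewrite !mxE scaler_suml; apply: eq_bigr => i _.
rewrite mxE (homogeneous_frame _ _ hM) -scalerAl -scalerAr -mpolyXD scalerA.
have [->|/v_g le_g] := eqVneq (v 0 i) 0; first by rewrite !mul0r !scale0r.
have [->|/(frame_neq0 hM) le_a] := eqVneq (frame M al be i j) 0.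
  by rewrite !mulr0 !scale0r.
congr (_ *: 'X_[_]); apply/mnmP=> k; rewrite mnmDE !mnmBE.
move/mnm_lepP/(_ k): le_g; move/mnm_lepP/(_ k): le_a => *.
by rewrite addnBA // subnK.
Qed.

(** A homogeneous matrix acts on each multigraded component separately, so
    that inhomogeneous preimages can be replaced by homogeneous ones. *)
Lemma component_mul p q (M : 'M_(p, q)) al be g w :
    homogeneous M al be ->
  component be g (w *m M) = component al g w *m frame M al be.
Proof.
move=> hM; apply/rowP=> j; rewrite !mxE.
have split_entry i : (be j <= g)%MM ->
    (w 0 i * M i j)@_(g - be j) = component al g w 0 i * frame M al be i j.
  move=> le_bg; rewrite (homogeneous_frame _ _ hM) -scalerAr mcoeffZ mulrC.
  have [->|/(frame_neq0 hM) le_ba] := eqVneq (frame M al be i j) 0.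
    by rewrite !mulr0.
  suff -> : (w 0 i * 'X_[al i - be j])@_(g - be j) = component al g w 0 i by [].
  rewrite mcoeffMX_sub [RHS]mxE.
  have <- : (al i <= g)%MM = (al i - be j <= g - be j)%MM.
    apply/mnm_lepP/mnm_lepP => h k; move: (h k); rewrite !mnmBE.
      by move=> /leq_sub2r; apply.
    move/mnm_lepP/(_ k): le_bg => le_bg.
    move/mnm_lepP/(_ k): le_ba => le_ba.
    by rewrite -(leq_add2r (be j k)) !subnK.
  case le_ag: (al i <= g)%MM; last by [].
  suff -> : (g - be j - (al i - be j) = g - al i)%MM by [].
  apply/mnmP=> k; rewrite !mnmBE.
  move/mnm_lepP/(_ k): le_ba => le_ba; move/mnm_lepP/(_ k): le_ag => le_ag.
  by rewrite subnBA // subnK // (leq_trans le_ba).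
case: ifPn => [le_bg|not_le].
  by rewrite raddf_sum; apply: eq_bigr => i _; apply: split_entry.
rewrite big1 // => i _.
have [->|/(frame_neq0 hM) le_ba] := eqVneq (frame M al be i j) 0.
  by rewrite mulr0.
rewrite [component _ _ _ _ _]mxE ifN ?mul0r //; apply: contra not_le.
exact: lepm_trans le_ba.
Qed.

(** Exactness in multidegree g: lift the coefficient vector to a homogeneous
    cycle, write it as a boundary, and take the component of multidegree g of
    the preimage. *)
Lemma frame_exact p q r (M1 : 'M_(p, q)) (M2 : 'M_(r, p)) al be ga g v :
    homogeneous M1 al be -> homogeneous M2 ga al ->
    (forall w : 'rV_p, w *m M1 = 0 -> exists w', w = w' *m M2) ->
    below al g v -> v *m frame M1 al be = 0 ->
  exists2 w, below ga g w & v = w *m frame M2 ga al.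
Proof.
move=> h1 h2 ex_M v_g vM0; have /ex_M[w dw] : homogenize al g v *m M1 = 0.
  rewrite (homogenize_mul h1 v_g) vM0; apply/rowP=> j.
  by rewrite !mxE scale0r.
exists (component ga g w); first exact: component_below.
by rewrite -(component_mul _ _ h2) -dw homogenizeK.
Qed.

Lemma frame_complex p q r (M1 : 'M_(p, q)) (M2 : 'M_(r, p)) al be ga :
    homogeneous M1 al be -> homogeneous M2 ga al -> M2 *m M1 = 0 ->
  frame M2 ga al *m frame M1 al be = 0.
Proof.
move=> h1 h2 M0; apply/row_matrixP=> i; rewrite row0 rowE.
have dv := @below_delta _ ga i.
rewrite mulmxA -(homogenizeK dv) -!component_mul // -mulmxA M0 mulmx0.
by apply/rowP=> j; rewrite !mxE mcoeff0 if_same.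
Qed.

End Frames.

(** * The linear strand of a minimal multigraded resolution *)

Section Shifts.
Variables (K : fieldType) (N : nat).
Local Notation R := {mpoly K[N]}.
Variables (I : R -> Prop) (F : free_complex R).
Variable a : forall t : nat, 'I_(fc_rank F t) -> 'X_{1..N}.
Arguments a : clear implicits.
Hypothesis resF : is_min_multigraded_resolution (F := F) a I.

Local Notation e := (frame (fc_aug F) (a 0) (fun=> 0%MM)).
Local Notation d t := (frame (fc_diff F t) (a t.+1) (a t)).
Local Notation V t := (below (a t)).

Lemma aug_homogeneous : homogeneous (fc_aug F) (a 0) (fun=> 0%MM).
Proof.
move=> i j u; rewrite ord1 addm0; have [_ _ [h _]] := resF; exact: h.
Qed.
Arguments aug_homogeneous : clear implicits.

Lemma diff_homogeneous t : homogeneous (fc_diff F t) (a t.+1) (a t).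
Proof. have [_ _ [_ h]] := resF; exact: h. Qed.
Arguments diff_homogeneous : clear implicits.

Lemma strand_exact0 g v : V 0 g v -> v *m e = 0 ->
  exists2 w, V 1 g w & v = w *m d 0.
Proof.
apply: (frame_exact aug_homogeneous (diff_homogeneous 0) _).
by have [[_ _ h _] _ _] := resF; move=> w /h.
Qed.

Lemma strand_exactS t g v : V t.+1 g v -> v *m d t = 0 ->
  exists2 w, V t.+2 g w & v = w *m d t.+1.
Proof.
apply: (frame_exact (diff_homogeneous t) (diff_homogeneous t.+1) _).
by have [[_ _ _ h] _ _] := resF; move=> w /h.
Qed.

Lemma strand_complex0 : d 0 *m e = 0.
Proof.
apply: (frame_complex aug_homogeneous (diff_homogeneous 0) _).
have [[_ _ h _] _ _] := resF; apply/row_matrixP=> i.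
by rewrite row0 rowE mulmxA; apply/h; exists (delta_mx 0 i).
Qed.

Lemma strand_complexS t : d t.+1 *m d t = 0.
Proof.
apply: (frame_complex (diff_homogeneous t) (diff_homogeneous t.+1) _).
have [[_ _ _ h] _ _] := resF; apply/row_matrixP=> i.
by rewrite row0 rowE mulmxA; apply/h; exists (delta_mx 0 i).
Qed.

Lemma strand_aug_hit g : I 'X_[g] -> exists2 v, V 0 g v & v *m e = 1%:M.
Proof.
have [[_ h _ _] _ _] := resF; case/h=> w dw.
exists (component (a 0) g w); first exact: component_below.
rewrite -component_mul ?dw; last exact: aug_homogeneous.
apply/rowP=> j; rewrite ord1 !mxE subm0 eqxx mulr1n mcoeffX eqxx.
by rewrite ifT //; apply/mnm_lepP=> k; rewrite mnm0E.
Qed.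

Lemma shift_mem i : e i 0 != 0 -> I 'X_[a 0 i].
Proof.
have [[_ h _ _] _ _] := resF => nz; apply/h.
have := homogeneous_frame i 0 aug_homogeneous; rewrite subm0.
move: (e i 0) nz => c nz de.
exists (c^-1%:MP *: delta_mx 0 i); rewrite -scalemxAl -rowE.
apply/rowP=> j; rewrite ord1 !mxE mulr1n de mul_mpolyC.
by rewrite scalerA mulVf ?scale1r.
Qed.

(** A differential without constant entries strictly raises the multidegree;
    the only possible nonzero entry between equal shifts would be constant. *)
Lemma shift_lt t i j : d t i j != 0 ->
  (a t j <= a t.+1 i)%MM /\ (mdeg (a t j) < mdeg (a t.+1 i))%N.
Proof.
move=> nz; have le_a := frame_neq0 (diff_homogeneous t) nz; split=> //.
rewrite ltnNge; apply: contra nz => /(lem_mdeg_eq le_a) eq_a.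
have [_ /(_ t i j) hmin _] := resF; rewrite mxE -eq_a.
by rewrite -[X in (X - _)%MM]add0m addmK hmin.
Qed.

(** In multidegree a t i, a boundary could hit the basis vector i only through
    shifts strictly above a t i, which do not contribute to that multidegree. *)
Lemma delta_not_boundary t i w : V t.+1 (a t i) w -> delta_mx 0 i <> w *m d t.
Proof.
move=> w_a /rowP/(_ i); rewrite !mxE !eqxx big1 => [/eqP|k _].
  by rewrite oner_eq0.
apply/eqP; rewrite mulf_eq0; apply/norP=> -[/w_a le_a /shift_lt[_]].
by rewrite ltnNge lem_mdeg.
Qed.

Lemma aug_neq0 i : e i 0 != 0.
Proof.
apply/eqP=> e0; have := @strand_exact0 (a 0 i) (delta_mx 0 i).
case=> [||w w_a]; [exact: below_delta| |exact: delta_not_boundary].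
by rewrite -rowE; apply/rowP=> j; rewrite ord1 [LHS]mxE e0 mxE.
Qed.

Lemma row_diff_neq0 t i : row i (d t) != 0.
Proof.
apply/eqP=> d0; have := @strand_exactS t (a t.+1 i) (delta_mx 0 i).
case=> [||w w_a]; [exact: below_delta| |exact: delta_not_boundary].
by rewrite -rowE.
Qed.

Section LinearStrand.
Variable m : nat.
Hypothesis I_deg : forall g, I 'X_[g] -> (m <= mdeg g)%N.

(** Each differential raises the degree of shifts by at least one. *)
Lemma shift_deg t i : (m + t <= mdeg (a t i))%N.
Proof.
elim: t i => [|t IHt] i; first by rewrite addn0; apply/I_deg/shift_mem/aug_neq0.
have [j nz] : exists j, d t i j != 0.
  have /rV0Pn[j] := row_diff_neq0 i; by rewrite mxE; exists j.
by rewrite addnS (leq_ltn_trans (IHt j)) //; case: (shift_lt nz).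
Qed.

Lemma below_deg_eq0 t g (v : 'rV[K]_(fc_rank F t)) :
  V t g v -> (mdeg g < m + t)%N -> v = 0.
Proof.
move=> v_g lt_g; apply/rowP=> i; rewrite mxE.
apply: contraTeq lt_g => /v_g le_g.
by rewrite -leqNgt (leq_trans (shift_deg i)) // lem_mdeg.
Qed.

(** The Koszul cycle on three variables.  Lifts of the three monomials
    X^b X_ki to F_0 differ by boundaries of three elements of F_1, whose sum is
    a cycle, hence the boundary of some z of multidegree X^b X_k1 X_k2 X_k3.
    If z = 0, the three elements of F_1 cancel although they have pairwise
    incomparable multidegrees, so they vanish and the lifts coincide, in
    multidegree X^b, where F_0 is zero.  So z is nonzero, and for degree
    reasons its multidegree is itself a shift. *)
Lemma shift_triangle b k1 k2 k3 :
    m = (mdeg b).+1 -> uniq [:: k1; k2; k3] ->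
    (forall k, k \in [:: k1; k2; k3] -> I 'X_[b + U_(k)]) ->
  exists j, a 2 j = (b + U_(k1) + U_(k2) + U_(k3))%MM.
Proof.
move=> dm uk Ik; rewrite /= !inE negb_or andbT in uk.
have{uk} [/andP[k12 k13] k23] := andP uk.
have lift k : k \in [:: k1; k2; k3] ->
    exists2 v, V 0 (b + U_(k))%MM v & v *m e = 1%:M.
  by move/Ik/strand_aug_hit.
have edge k l v w :
    V 0 (b + U_(k))%MM v -> V 0 (b + U_(l))%MM w -> v *m e = 1%:M ->
    w *m e = 1%:M -> exists2 s, V 1 (b + U_(k) + U_(l))%MM s & v - w = s *m d 0.
  move=> v_k w_l ve we; apply: strand_exact0; last first.
    by rewrite mulmxBl ve we subrr.
  apply: belowD; last apply: belowN.
    exact: below_le (lem_addr _ _) v_k.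
  by apply: below_le w_l; rewrite addmAC lem_addr.
have [v1 b1 e1] := lift k1 (mem_head _ _).
have [v2 b2 e2] : exists2 v, V 0 (b + U_(k2))%MM v & v *m e = 1%:M.
  by apply: lift; rewrite !inE eqxx orbT.
have [v3 b3 e3] : exists2 v, V 0 (b + U_(k3))%MM v & v *m e = 1%:M.
  by apply: lift; rewrite !inE eqxx !orbT.
have [s12 b12 d12] := edge _ _ _ _ b1 b2 e1 e2.
have [s23 b23 d23] := edge _ _ _ _ b2 b3 e2 e3.
have [s31 b31 d31] := edge _ _ _ _ b3 b1 e3 e1.
pose y := (b + U_(k1) + U_(k2) + U_(k3))%MM.
have [z z_y dz] : exists2 z, V 2 y z & s12 + s23 + s31 = z *m d 1.
  apply: strand_exactS.
    apply: belowD; first apply: belowD.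
    - exact: below_le (lem_addr _ _) b12.
    - by apply: below_le b23; apply/mnm_lepP=> i; rewrite !mnmDE; lia.
    by apply: below_le b31; apply/mnm_lepP=> i; rewrite !mnmDE; lia.
  rewrite !mulmxDl -d12 -d23 -d31.
  by rewrite !subrKA subrr.
have [z0|/rV0Pn[j /z_y le_j]] := eqVneq z 0; last first.
  exists j; apply: (lem_mdeg_eq le_j).
  by apply: leq_trans (shift_deg j); rewrite /y !mdegD !mdeg1 dm !addn1 addn2.
(* A shift of F_1 supporting s12 also supports s23 or s31, so it divides
   a monomial of degree m. *)
have s12_0 : s12 = 0.
  apply/rowP=> i; rewrite mxE; apply/eqP; apply: contraT => nz.
  have := congr1 (fun v : 'rV_ _ => v 0 i) dz.
  rewrite z0 mul0mx !mxE -addrA => /eqP; rewrite addr_eq0 => /eqP s12N.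
  have le12 := b12 _ nz.
  have: (s23 0 i != 0) || (s31 0 i != 0).
    by apply: contraNT nz; rewrite negb_or !negbK s12N => /andP[/eqP-> /eqP->];
       rewrite addr0 oppr0.
  case/orP=> [/b23|/b31] le3.
    have := shift_deg i; rewrite leqNgt => /negP[].
    suff /lem_mdeg : (a 1 i <= b + U_(k2))%MM by rewrite mdegD mdeg1 dm; lia.
    by apply: (lem_meet k13) => //; rewrite addmAC.
  have := shift_deg i; rewrite leqNgt => /negP[].
  suff /lem_mdeg : (a 1 i <= b + U_(k1))%MM by rewrite mdegD mdeg1 dm; lia.
  by apply: (lem_meet k23) => //; rewrite addmAC.
move: e1; suff -> : v1 = 0.
  by rewrite mul0mx => /matrixP/(_ 0 0)/eqP; rewrite !mxE eq_sym oner_eq0.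
have v12 : v1 = v2 by apply/eqP; rewrite -subr_eq0 d12 s12_0 mul0mx.
apply: (@below_deg_eq0 0 b); last by rewrite dm addn0.
by move=> i nz; apply: (lem_meet k12); [apply: b1 | apply: b2; rewrite -v12].
Qed.

(** Write the boundary of the basis vector j of F_2 as the sum over p of
    X_p A_p, and the boundary of A_p as the sum over q of X_q C_pq.  For degree
    reasons A and C have constant coefficients.  As the composite of two
    differentials is zero, C is alternating and the images c_pq of the C_pq
    under the augmentation have zero row sums.  These c_pq are not all zero,
    since otherwise the C_pq, then the A_p, and then the boundary of j would
    vanish, there being no boundaries in such small degrees.  The nonzero
    c_pq are the edges of the graph; a row with zero sum cannot have a single
    nonzero entry. *)
Lemma shift_cycle j : mdeg (a 2 j) = m.+2 ->
  exists E : rel 'I_N,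
    [/\ ssrbool.symmetric E, irreflexive E, exists p q, E p q,
        forall p q, E p q -> exists2 q', q' != q & E p q'
      & forall p q, E p q ->
          exists2 g, I 'X_[g] & a 2 j = (g + U_(p) + U_(q))%MM].
Proof.
set y := a 2 j => dy.
pose A p : 'rV[K]_(fc_rank F 1) :=
  \row_i (d 1 j i *+ (y == (a 1 i + U_(p))%MM)).
pose C p q : 'rV[K]_(fc_rank F 0) :=
  \row_s ((A p *m d 0) 0 s *+ (y == (a 0 s + U_(p) + U_(q))%MM)).
pose c p q := (C p q *m e) 0 0.
have A_mul p s : (A p *m d 0) 0 s =
    \sum_i d 1 j i * d 0 i s *+ (y == (a 1 i + U_(p))%MM).
  by rewrite mxE; apply: eq_bigr => i _; rewrite [A p 0 i]mxE mulrnAl.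
have sum_pick (x : K) (g : 'X_{1..N}) k : y = (g + U_(k))%MM ->
    \sum_p (x *+ (y == (g + U_(p))%MM)) = x.
  move=> dyg; rewrite (bigD1 k) //= dyg eqxx big1 ?addr0 // => p ne_p.
  by rewrite eqm_add2l eq_mnm1 eq_sym (negPf ne_p).
have cover1 i : d 1 j i != 0 -> exists k, y = (a 1 i + U_(k))%MM.
  move=> /shift_lt[le_a lt_a]; apply: lem_cover => //; apply/eqP.
  by rewrite eqn_leq lt_a andbT -/y dy; have := shift_deg i; rewrite addn1.
have sum_A : row j (d 1) = \sum_p A p.
  apply/rowP=> i; rewrite summxE [LHS]mxE.
  under eq_bigr => p _ do rewrite [A p 0 i]mxE.
  have [d0|/cover1[k dk]] := eqVneq (d 1 j i) 0; last first.
    by rewrite (sum_pick _ _ _ dk).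
  by rewrite d0 big1 // => p _; rewrite mul0rn.
have sum_C p : A p *m d 0 = \sum_q C p q.
  apply/rowP=> s; rewrite summxE.
  under eq_bigr => q _ do rewrite [C p q 0 s]mxE.
  have [->|nz] := eqVneq ((A p *m d 0) 0 s) 0.
    by rewrite big1 // => q _; rewrite mul0rn.
  have /existsP[i /andP[/eqP dyi nz0]] :
      [exists i, (y == (a 1 i + U_(p))%MM) && (d 0 i s != 0)].
    apply: contraNT nz => /existsPn h.
    rewrite A_mul big1 // => i _; move: (h i); rewrite negb_and negbK.
    by case/orP=> [/negPf->|/eqP->]; rewrite ?mulr0n // mulr0 mul0rn.
  have [le_a lt_a] := shift_lt nz0.
  have [|k dk] := lem_cover le_a.
    apply/eqP; rewrite eqn_leq lt_a andbT; have := shift_deg s.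
    by move: dy; rewrite dyi mdegD mdeg1; lia.
  rewrite -[LHS](sum_pick _ (a 0 s + U_(p))%MM k) //.
  by rewrite dyi dk addmAC.
have C_alt p q s : y = (a 0 s + U_(p) + U_(q))%MM ->
    (A p *m d 0) 0 s + (A q *m d 0) 0 s *+ (p != q) = 0.
  move=> dys; rewrite !A_mul -sumrMnl -big_split /=.
  transitivity ((d 1 *m d 0) j s); last by rewrite strand_complexS mxE.
  rewrite mxE; apply: eq_bigr => i _.
  have [->|/cover1[r dr]] := eqVneq (d 1 j i) 0.
    by rewrite mul0r !mul0rn addr0.
  have [->|/shift_lt[le_a _]] := eqVneq (d 0 i s) 0.
    by rewrite mulr0 !mul0rn addr0.
  rewrite dr !eqm_add2l !eq_mnm1 -mulrnA -mulrnDr.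
  suff -> : (((r == p) + (r == q) * (p != q))%N = 1)%N by rewrite mulr1n.
  have /mnmP/(_ r) := etrans (esym dr) dys.
  move/mnm_lepP/(_ r): le_a.
  rewrite !mnmDE !mnm1E eqxx [p == r]eq_sym [q == r]eq_sym.
  have [<-|ne_p] := eqVneq r p; first by have [_|_] := eqVneq r q; lia.
  have [<-|_] := eqVneq r q; last by lia.
  by rewrite eq_sym ne_p; lia.
have CE p q s : C p q 0 s != 0 -> y = (a 0 s + U_(p) + U_(q))%MM.
  by rewrite [C p q 0 s]mxE; case: (y =P _) => //; rewrite mulr0n eqxx.
have C_diag p : C p p = 0.
  apply/rowP=> s; rewrite [RHS]mxE; apply/eqP/contraT => nz.
  have := C_alt _ _ _ (CE _ _ _ nz); rewrite eqxx addr0.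
  by move: nz; rewrite [C p p 0 s]mxE => /[swap]->; rewrite mul0rn eqxx.
have C_anti p q : p != q -> C q p = - C p q.
  move=> ne_pq; apply/rowP=> s; rewrite [RHS]mxE ![C _ _ _ _]mxE.
  rewrite [(a 0 s + _ + U_(p))%MM]addmAC.
  case: eqP => [dys|_]; last by rewrite oppr0.
  apply/eqP; rewrite -addr_eq0 addrC.
  by have := C_alt _ _ _ dys; rewrite ne_pq => ->.
have c_anti p q : c q p = - c p q.
  have [->|ne_pq] := eqVneq p q; first by rewrite /c C_diag mul0mx mxE oppr0.
  by rewrite /c C_anti // mulNmx mxE.
have sum_c p : \sum_q c p q = 0.
  rewrite -summxE -mulmx_suml -sum_C -mulmxA strand_complex0 mulmx0; exact: mxE.
have C_eq0 p q : c p q = 0 -> C p q = 0.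
  move=> c0; have [//|/rV0Pn[s0 /CE dys0]] := eqVneq (C p q) 0.
  have deg0 : mdeg (a 0 s0) = m.
    by move: dy; rewrite dys0 !mdegD !mdeg1 !addn1 => -[].
  have [|//|w w_g ->] := @strand_exact0 (a 0 s0) (C p q).
  - move=> s /CE; rewrite dys0 => /eqP; rewrite !eqm_add2r => /eqP ->.
    exact: lepm_refl.
  - by apply/rowP=> k; rewrite ord1 [RHS]mxE; exact: c0.
  by rewrite (below_deg_eq0 w_g) ?mul0mx // deg0 addn1.
have A_eq0 p : A p *m d 0 = 0 -> A p = 0.
  move=> A0; have [//|/rV0Pn[i0]] := eqVneq (A p) 0.
  have AE i : A p 0 i != 0 -> y = (a 1 i + U_(p))%MM.
    by rewrite [A p 0 i]mxE; case: (y =P _) => //; rewrite mulr0n eqxx.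
  move=> /AE dyi0; have deg0 : mdeg (a 1 i0) = m.+1.
    by move: dy; rewrite dyi0 !mdegD !mdeg1 !addn1 => -[].
  have [|//|w w_g ->] := @strand_exactS 0 (a 1 i0) (A p).
    move=> i /AE; rewrite dyi0 => /eqP; rewrite !eqm_add2r => /eqP ->.
    exact: lepm_refl.
  by rewrite (below_deg_eq0 w_g) ?mul0mx // deg0 addn2.
exists (fun p q => c p q != 0); split=> [p q|p||p q nz|p q].
- by rewrite c_anti oppr_eq0.
- by rewrite /c C_diag mul0mx mxE eqxx.
- suff /existsP[p /existsP[q nz]] : [exists p, [exists q, c p q != 0]].
    by exists p, q.
  have := row_diff_neq0 (t := 1) j; apply: contraNT => /existsPn c0.
  rewrite sum_A big1 // => p _; apply: A_eq0; rewrite sum_C big1 // => q _.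
  by apply/C_eq0/eqP; have /existsPn/(_ q) := c0 p; rewrite negbK.
- suff /exists_inP[q' ne_q nz'] : [exists (q' | q' != q), c p q' != 0].
    by exists q'.
  apply: contraNT nz => /exists_inPn c0.
  have := sum_c p; rewrite (bigD1 q) //= big1 ?addr0 => [->//|q' /c0].
  by rewrite negbK => /eqP.
move=> nz; have /rV0Pn[s /CE dys] : C p q != 0.
  by apply: contraNneq nz => C0; rewrite /c C0 mul0mx mxE.
by exists (a 0 s); first exact/shift_mem/aug_neq0.
Qed.
End LinearStrand.
End Shifts.

(** * Linear resolutions of monomial ideals *)

Section LinearLinkage.
Variables (K : fieldType) (N : nat).
Local Notation R := {mpoly K[N]}.

(** If y is the only monomial of q dividing x + y, only one pair of monomials
    contributes to the coefficient of x + y in the product. *)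
Lemma mcoeffM_unique (p q : R) x y :
  (forall z, z \in msupp q -> (z <= x + y)%MM -> z = y) ->
  (p * q)@_(x + y) = p@_x * q@_y.
Proof.
move=> uq; rewrite {1}(mpolyE q) mulr_sumr raddf_sum /=.
under eq_bigr => z _ do rewrite -scalerAr mcoeffZ mcoeffMX_sub.
have [yq|nyq] := boolP (y \in msupp q); last first.
  rewrite (memN_msupp_eq0 nyq) mulr0 big_seq big1 // => z zq.
  case: ifP => [/(uq _ zq) zy|_]; last exact: mulr0.
  by rewrite -zy zq in nyq.
rewrite (bigD1_seq y) //= lem_addl addmK mulrC big_seq_cond big1 ?addr0 //.
move=> z /andP[zq ne_z]; case: ifP => [/(uq _ zq) zy|_]; last exact: mulr0.
by rewrite zy eqxx in ne_z.
Qed.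

Lemma mcoeffM_linear (p q : R) y :
  (forall z, z \in msupp q -> mdeg z = 1%N) ->
  (p * q)@_y =
    \sum_(l | (U_(l) <= y)%MM) p@_(y - U_(l)) * q@_U_(l).
Proof.
move=> q1; have -> : q = \sum_l q@_U_(l) *: 'X_l.
  apply/mpolyP=> z; rewrite raddf_sum /=.
  under eq_bigr => l _ do rewrite mcoeffZ mcoeffX.
  have [/mdeg1P[k /eqP ->]|nz] := boolP (mdeg z == 1%N).
    rewrite (bigD1 k) //= eqxx mulr1 big1 ?addr0 // => l ne_l.
    by rewrite eq_mnm1 (negPf ne_l) mulr0.
  rewrite memN_msupp_eq0; last by apply: contra nz => /q1 ->.
  rewrite big1 // => l _; case: eqP => [dz|]; last by rewrite mulr0.
  by rewrite -dz mdeg1 in nz.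
rewrite mulr_sumr raddf_sum [RHS]big_mkcond /=; apply: eq_bigr => l _.
rewrite -scalerAr mcoeffZ mcoeffMX_sub.
case: ifP => _; last by rewrite mulr0.
rewrite mulrC raddf_sum /= (bigD1 l) //= mcoeffZ mcoeffX eqxx mulr1.
rewrite big1 ?addr0 // => k ne_k.
by rewrite mcoeffZ mcoeffX eq_mnm1 (negPf ne_k) mulr0.
Qed.

(** Stated by contraposition: the hypothesis link says that no generator other
    than u can be reached from u by multiplying by a variable X_k with
    u_k < v_k.  Let g_i be the images in J of the basis of the linear
    resolution; they are homogeneous of degree D.  Writing X^u and X^v in terms
    of the g_i, the relation X^(v-u) X^u = X^(u-v) X^v (truncated
    differences) becomes a syzygy s of the g_i.  The functional psi, which
    extracts from the formal sum of the s_i g_i the part of the coefficient of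
    lcm(u, v) coming from the monomial X^u of the g_i, takes the value 1 on s.
    But it vanishes on the multiples of every linear syzygy, because u is by
    hypothesis the only monomial of any g_i that divides u * X_k. *)
Lemma linear_resolution_linkage (T : Type) (b : T -> 'X_{1..N}) D u v :
    let J : R -> Prop := ideal_gen (fun x => exists j, x = 'X_[b j]) in
    (forall j, (D <= mdeg (b j))%N) ->
    J 'X_[u] -> J 'X_[v] -> mdeg u = D -> mdeg v = D -> u != v ->
    (forall k j, (u k < v k)%N -> mdeg (b j) = D ->
       (b j <= u + U_(k))%MM -> b j = u) ->
  ~ has_linear_resolution J.
Proof.
move=> J bD Ju Jv du dv ne_uv link [d [F [[_ memJ kerJ _] _ [gr0 gr1]]]].
pose g i := fc_aug F i 0.
have augE (w : 'rV_(fc_rank F 0)) : w *m fc_aug F = (\sum_i w 0 i * g i)%:M.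
  by apply/rowP=> j; rewrite ord1 !mxE mulr1n.
have gJ i : J (g i).
  apply/memJ; exists (delta_mx 0 i); rewrite -rowE.
  by apply/rowP=> j; rewrite ord1 !mxE mulr1n.
have g_supp i z : z \in msupp (g i) -> exists2 j, (b j <= z)%MM & mdeg z = d.
  move=> zg; have dz : mdeg z = d by rewrite (gr0 _ _ zg) addn0.
  have [|_ [j ->] le_j] :=
    ideal_gen_msupp (B := fun y => exists j, y = b j) _ (gJ i) zg.
    by move=> _ [j ->]; exists (b j) => //; exists j.
  by exists j.
have lift y : J 'X_[y] ->
    exists w : 'rV_(fc_rank F 0), 'X_[y] = \sum_i w 0 i * g i.
  case/memJ=> w; rewrite augE => /matrixP/(_ 0 0); rewrite !mxE !mulr1n => dw.
  by exists w.
have [c dc] := lift _ Ju; have [c' dc'] := lift _ Jv.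
(* X^u is a combination of the g_i, whose monomials are multiples of the
   generators. *)
have dD : d = D.
  have /existsP[i nz] : [exists i, (c 0 i * g i)@_u != 0].
    have := oner_neq0 K; apply: contraNT => /existsPn c0.
    have <- : ('X_[u] : R)@_u = 1 by rewrite mcoeffX eqxx.
    rewrite dc raddf_sum big1 // => i _.
    by have /negPn/eqP := c0 i.
  move: nz; rewrite -mcoeff_msupp => /msuppM_le/allpairsP[[y z] /= [_ zg uyz]].
  have [j le_j dz] := g_supp _ _ zg.
  apply/eqP; rewrite eqn_leq -{1}du uyz mdegD -dz leq_addl.
  by rewrite (leq_trans (bD j)) // lem_mdeg.
rewrite {}dD in gr0 gr1 g_supp *.
have coef0 i : (c 0 i * g i)@_u = (c 0 i)@_0%MM * (g i)@_u.
  rewrite -[in LHS](add0m u); apply: mcoeffM_unique => z zg.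
  rewrite add0m => /lem_mdeg_eq; apply.
  by have [_ _ ->] := g_supp _ _ zg; rewrite du.
have coefU i k (p : R) : (u k < v k)%N ->
    (p * g i)@_(U_(k) + u) = p@_U_(k) * (g i)@_u.
  move=> lt_k; apply: mcoeffM_unique => z zg le_z.
  have [j le_j dz] := g_supp _ _ zg.
  have bz : b j = z by apply: (lem_mdeg_eq le_j); rewrite dz bD.
  by rewrite -bz; apply: (link k) => //; rewrite bz // addmC.
pose psi (s : 'rV_(fc_rank F 0)) := \sum_i (s 0 i)@_(v - u) * (g i)@_u.
pose s := 'X_[v - u] *: c - 'X_[u - v] *: c'.
have psi1 : psi s = 1.
  transitivity (\sum_i (c 0 i * g i)@_u); last first.
    by rewrite -raddf_sum /= -dc mcoeffX eqxx.
  apply: eq_bigr => i _; rewrite coef0 !mxE mcoeffB ![_ * (_ 0 i)]mulrC.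
  rewrite !mcoeffMX_sub lepm_refl ifN; last first.
    apply: contra ne_uv => /mnm_lepP le_uv.
    apply/eqP/lem_mdeg_eq; last by rewrite du dv.
    by apply/mnm_lepP=> k; move: (le_uv k); rewrite !mnmBE; lia.
  by rewrite subr0 -[X in (X - _)%MM]add0m addmK.
have [h dh] : exists h, s = h *m fc_diff F 0.
  apply/kerJ; rewrite mulmxBl -!scalemxAl !augE -dc -dc' -!mul_scalar_mx.
  rewrite -!scalar_mxM -!mpolyXD; apply/eqP; rewrite subr_eq0; apply/eqP.
  by rewrite addmC -mlcmE mlcmC mlcmE addmC.
have: psi s = 0; last by rewrite psi1 => /eqP; rewrite oner_eq0.
rewrite /psi dh.
under eq_bigr => i _ do rewrite mxE raddf_sum /= mulr_suml.
rewrite exchange_big big1 // => k _.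
under eq_bigr => i _.
  rewrite mcoeffM_linear; last first.
    by move=> z /gr1; lia.
  rewrite mulr_suml; over.
rewrite exchange_big big1 // => l /mnm_lepP/(_ l).
rewrite mnmBE mnm1E eqxx => lt_l.
have {}lt_l : (u l < v l)%N by lia.
under eq_bigr => i _ do rewrite -mulrA -(coefU _ _ _ lt_l).
rewrite -mulr_sumr -raddf_sum /=.
have -> : \sum_i fc_diff F 0 k i * g i = 0.
  have : row k (fc_diff F 0) *m fc_aug F = 0.
    by apply/kerJ; exists (delta_mx 0 k); rewrite rowE.
  rewrite augE => /matrixP/(_ 0 0); rewrite !mxE mulr1n.
  by under eq_bigr => i _ do rewrite mxE.
by rewrite raddf0 mulr0.
Qed.

End LinearLinkage.

(** * Monomials attached to graphs of maps *)

Section LatticePaths.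
Variables (d : Order.disp_t) (P : finPOrderType d) (n : nat).
Implicit Type f : P -> 'I_n.

Definition cell (p : P) (i : 'I_n) : 'I_(nvars P n) := enum_rank (p, i).

Definition graph_mnm f : 'X_{1..nvars P n} := (\sum_p U_(cell p (f p)))%MM.

Lemma cell_eq p i q j : (cell p i == cell q j) = (p == q) && (i == j).
Proof. by rewrite (inj_eq enum_rank_inj) xpair_eqE. Qed.

Lemma cellP k : exists p i, k = cell p i.
Proof.
exists (enum_val k).1, (enum_val k).2.
by rewrite /cell -surjective_pairing enum_valK.
Qed.

Lemma graph_mnmE f p i : graph_mnm f (cell p i) = (f p == i).
Proof.
rewrite mnm_sumE (bigD1 p) //= mnm1E cell_eq eqxx big1 ?addn0 // => q ne_q.
by rewrite mnm1E cell_eq (negPf ne_q).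
Qed.

Lemma mdeg_graph f : mdeg (graph_mnm f) = #|P|.
Proof.
rewrite mdeg_sum; under eq_bigr => p _ do rewrite mdeg1.
by rewrite sum1_card.
Qed.

Lemma graph_mnm_D1 f p :
  graph_mnm f = (\sum_(q | q != p) U_(cell q (f q)) + U_(cell p (f p)))%MM.
Proof. by rewrite /graph_mnm (bigD1 p) //= addmC. Qed.

Variable K : fieldType.

Lemma Umon_graph f : Umon K f = 'X_[graph_mnm f].
Proof. by rewrite /Umon /Xvar mprodXE. Qed.

Lemma Lideal_graph f : isotone f -> Lideal K P n 'X_[graph_mnm f].
Proof.
move=> iso_f; apply: ideal_gen_mulX (lepm_refl _).
by exists f; rewrite ?Umon_graph.
Qed.

Lemma LidealP g : Lideal K P n 'X_[g] ->
  exists2 f, isotone f & (graph_mnm f <= g)%MM.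
Proof.
pose B y := exists2 f : P -> 'I_n, isotone f & y = graph_mnm f.
move=> /(ideal_gen_msupp (B := B)).
case/(_ g); rewrite ?msuppX ?mem_head //.
  by move=> _ [f iso_f ->]; exists (graph_mnm f); [exists f|rewrite Umon_graph].
by move=> _ [f iso_f ->] le_g; exists f.
Qed.

End LatticePaths.

(** * The two extreme lattice paths *)

Section Grid.
Variables m n : nat.
Local Notation rows := 'I_m.+3.
Local Notation cols := 'I_n.+3.
Local Notation col k := (inord k : cols).
Local Notation cell := (@cell _ rows n.+3).
Implicit Types (f : rows -> cols) (p r : rows) (i c : cols).

Definition spike r c i : rows -> cols := fun p => if p == r then i else c.

Definition stem r c : 'X_{1..nvars rows n.+3} :=
  (\sum_(p | p != r) U_(cell p c))%MM.

(** For c = 0 and r the last row, or c = 2 and r the first row, this is an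
    extreme lattice path: it is the least common multiple of the monomials of
    the three maps spike r c 0, spike r c 1 and spike r c 2. *)
Definition hook r c : 'X_{1..nvars rows n.+3} :=
  (stem r c + U_(cell r (col 0)) + U_(cell r (col 1)) + U_(cell r (col 2)))%MM.

Lemma col_val k : (k < 3)%N -> col k = k :> nat.
Proof. by move=> lt_k; rewrite inordK // (leq_trans lt_k). Qed.

Lemma graph_spike r c i :
  graph_mnm (spike r c i) = (stem r c + U_(cell r i))%MM.
Proof.
rewrite (graph_mnm_D1 _ r) /spike eqxx; congr (_ + _)%MM.
by apply: eq_bigr => p /negPf ->.
Qed.

Lemma mdeg_stem r c : mdeg (stem r c) = m.+2.
Proof.
have := mdeg_graph (spike r c c).
by rewrite graph_spike mdegD mdeg1 card_ord addn1 => -[].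
Qed.

Lemma mdeg_hook r c : mdeg (hook r c) = m.+3.+2.
Proof. by rewrite !mdegD !mdeg1 mdeg_stem !addn1. Qed.

Lemma hookE r c p i :
  hook r c (cell p i) = if p == r then (i <= 2)%N else i == c.
Proof.
rewrite !mnmDE !mnm1E !cell_eq ![r == p]eq_sym.
have -> : stem r c (cell p i) = (p != r) && (i == c) :> nat.
  have := graph_mnmE (spike r c i) p i.
  rewrite graph_spike mnmDE mnm1E cell_eq /spike eq_sym eqxx andbT.
  have [_|ne_p] := eqVneq p r; first by rewrite eqxx addn1 => -[].
  by rewrite addn0 eq_sym.
have [_|_] := eqVneq p r; last by rewrite !addn0.
rewrite -!val_eqE /= !col_val //; lia.
Qed.

Lemma isotone_spike_last i : isotone (spike ord_max (col 0) i).
Proof.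
move=> p q; rewrite !leEord /spike => le_pq.
case: (p =P ord_max) => [dp|_]; last by rewrite col_val.
suff -> : q = ord_max by rewrite eqxx.
by apply/val_inj/eqP; rewrite eqn_leq leq_ord -dp.
Qed.

Lemma isotone_spike_first i : (i <= 2)%N -> isotone (spike ord0 (col 2) i).
Proof.
move=> le_i p q; rewrite !leEord /spike => le_pq.
case: (q =P ord0) => [dq|_]; last by case: ifP; rewrite col_val.
suff -> : p = ord0 by rewrite eqxx.
by apply/val_inj/eqP; move: le_pq; rewrite dq leqn0.
Qed.

Variable K : fieldType.
Variables (F : free_complex {mpoly K[nvars rows n.+3]}).
Variable a : forall t : nat, 'I_(fc_rank F t) -> 'X_{1..nvars rows n.+3}.
Arguments a : clear implicits.
Hypothesis hF : is_min_multigraded_resolution (F := F) a (Lideal K rows n.+3).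

Lemma Lideal_deg g : Lideal K rows n.+3 'X_[g] -> (m.+3 <= mdeg g)%N.
Proof. by case/LidealP=> f _ /lem_mdeg; rewrite mdeg_graph card_ord. Qed.

Lemma hook_shift r c : (forall i, (i <= 2)%N -> isotone (spike r c i)) ->
  exists j, a 2 j = hook r c.
Proof.
move=> iso_spike; apply: (shift_triangle hF Lideal_deg).
- by rewrite mdeg_stem.
- by rewrite /= !inE !cell_eq !eqxx -!val_eqE /= !col_val.
have in_L k : (k < 3)%N ->
    Lideal K rows n.+3 'X_[stem r c + U_(cell r (col k))].
  move=> lt_k; rewrite -graph_spike.
  by apply/Lideal_graph/iso_spike; rewrite col_val.
by move=> k; rewrite !inE => /or3P[]/eqP->; apply: in_L.
Qed.

Local Notation u := (hook ord_max (col 0)).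
Local Notation v := (hook ord0 (col 2)).
Local Notation pen := (inord m.+1 : rows).

Lemma pen_val : pen = m.+1 :> nat.
Proof. by rewrite inordK. Qed.

(** The cells of v outside u: one cannot leave u towards v in the last row or
    in column 0, and v meets the rows other than 0 in column 2 only. *)
Lemma hook_step k : (u k < v k)%N ->
  exists p c, [/\ k = cell p c, (p < m.+2)%N, (0 < c)%N &
    ((0 < p) ==> (c == 2 :> nat))%N].
Proof.
have [p [c ->]] := cellP k; rewrite !hookE => lt_uv; exists p, c.
move: lt_uv; rewrite -!val_eqE /= !col_val //.
have := ltn_ord p; move: (nat_of_ord p) (nat_of_ord c) => x y lt_x.
case: (x =P m.+2) => [->|ne_x] /=; case: (x =P 0%N) => // x0 lt_uv;
  split=> //; lia.
Qed.

(** Let k be a cell of v outside u and y a shift of degree m + 5 (there are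
    m + 3 rows) dividing u * X_k.  If y differs from u, it uses the cell k.
    The isotone maps whose graph lies in u plus the cell k either stay in
    column 0 up to the penultimate row, or leave it exactly in that row; by
    monotonicity only one map does the latter ([path_uniq]), and it is the only
    one that can use the cell k.  Let z be the cell of the penultimate row in
    column 0, which the exceptional map avoids.  Every edge of the graph of
    [shift_cycle] comes from such a map.  As z occurs at most once in y, all
    edges at z come from the exceptional map, so there is at most one of them,
    and none as the graph has no leaf.  An edge avoiding both k and z comes
    from a map using k, hence from the exceptional one; then z does not occur
    in y, so that all edges come from the exceptional map and there is only
    this one, again a leaf.  So all edges meet k, and a star has leaves. *)
Lemma shift_near_hook j k : mdeg (a 2 j) = m.+3.+2 -> (u k < v k)%N ->
  (a 2 j <= u + U_(k))%MM -> a 2 j = u.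
Proof.
set y := a 2 j => dy lt_uv le_y; apply/eqP; apply/negPn/negP => ne_y.
have [p0 [c [dk lt_p0 c_gt0 /implyP c2]]] := hook_step lt_uv.
have pen_p q : (q < m.+2)%N -> (q <= pen)%N by rewrite pen_val.
have y_k : (0 < y k)%N.
  rewrite lt0n; apply: contra ne_y => /eqP y0; apply/eqP/lem_mdeg_eq.
    apply/mnm_lepP=> l; move/mnm_lepP/(_ l): le_y; rewrite mnmDE mnm1E.
    by have [<-|_] := eqVneq k l; rewrite ?y0 ?addn0.
  by rewrite dy mdeg_hook.
pose z := cell pen (col 0).
have u_z : u z = 1%N.
  rewrite hookE ifN ?eqxx //; apply/eqP=> /(congr1 val) /=.
  by rewrite pen_val => -[]; lia.
have ne_kz : k != z.
  rewrite dk cell_eq negb_and orbC -val_eqE /= col_val //; lia.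
have y_z : (y z <= 1)%N.
  by move/mnm_lepP/(_ z): le_y; rewrite mnmDE mnm1E (negPf ne_kz) addn0 u_z.
pose path f := isotone f /\ (graph_mnm f <= u + U_(k))%MM.
have path_low f p : path f -> (p < m.+2)%N ->
    f p = 0%N :> nat \/ p = p0 /\ f p = c.
  move=> [_ /mnm_lepP/(_ (cell p (f p)))] + lt_p.
  rewrite graph_mnmE eqxx mnmDE mnm1E dk cell_eq hookE ifN; last first.
    by apply: contraTneq lt_p => ->; rewrite /= ltnn.
  rewrite -[f p == _]val_eqE /= col_val //.
  case: eqP => [->|_]; first by left.
  rewrite add0n eq_sym [c == _]eq_sym.
  by case: andP => // -[/eqP<- /eqP<-]; right.
have path_last f : path f -> (f ord_max <= 2)%N.
  move=> [_ /mnm_lepP/(_ (cell ord_max (f ord_max)))].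
  rewrite graph_mnmE eqxx mnmDE mnm1E dk cell_eq hookE eqxx.
  suff /negPf -> : p0 != ord_max by rewrite addn0; case: (_ <= 2)%N.
  by apply: contraTneq lt_p0 => ->; rewrite /= ltnn.
have pathU f : path f -> f p0 = c -> f pen != 0%N :> nat.
  move=> [/(_ p0 pen) + _]; rewrite !leEord pen_p // => /(_ isT) + fp0.
  by rewrite fp0 => le_c; rewrite -lt0n (leq_trans c_gt0).
have path_uniq f : path f -> f pen != 0%N :> nat ->
    forall p, f p = (if (p < m.+1)%N then 0 else 2)%N :> nat.
  move=> pf; case: (path_low f pen pf); first by rewrite pen_val.
    by move=> ->; rewrite eqxx.
  move=> [p0E fpen] nz p.
  have c2' : c = 2%N :> nat by apply/eqP/c2; rewrite -p0E pen_val.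
  have [lt_p|ge_p] := ltnP p m.+1.
    case: (path_low f p pf) => [|//|[dp _]]; first by rewrite ltnW.
    by move: lt_p; rewrite dp -p0E pen_val ltnn.
  have [dp|gt_p] := eqVneq p pen; first by rewrite dp fpen.
  have -> : p = ord_max.
    apply/val_inj => /=; have := ltn_ord p.
    by move: gt_p; rewrite -val_eqE /= pen_val; lia.
  apply/eqP; rewrite eqn_leq path_last //= -c2' -fpen.
  by have := pf.1 pen ord_max; rewrite !leEord; apply; rewrite pen_val.
have path_eq f f' : path f -> path f' -> f pen != 0%N :> nat ->
    f' pen != 0%N :> nat -> graph_mnm f = graph_mnm f'.
  move=> pf pf' nz nz'; apply: eq_bigr => p _; congr U_(cell p _)%MM.
  by apply/val_inj; rewrite /= (path_uniq f pf nz) (path_uniq f' pf' nz').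
have avoid f : graph_mnm f z = 0%N -> f pen != 0%N :> nat.
  by rewrite graph_mnmE -val_eqE /= col_val //; case: eqP.
have [E [Esym Eirr [p [q Epq]] Edeg EI]] := shift_cycle hF Lideal_deg dy.
have Epath k1 q1 : E k1 q1 ->
    exists2 f, path f & y = (graph_mnm f + U_(k1) + U_(q1))%MM.
  case/EI=> g /LidealP[f iso_f le_fg]; rewrite -/y => dyg; exists f.
    split=> //; apply: lepm_trans le_y; rewrite dyg.
    by apply: lepm_trans le_fg _; rewrite -addmA lem_addr.
  rewrite (lem_mdeg_eq le_fg) // mdeg_graph card_ord.
  by move: dy; rewrite dyg !mdegD !mdeg1 !addn1 => -[->].
(* A second edge at k1 coming from the same map would have the same far
   end. *)
have no_edge k1 q1 : (forall f q2, y = (graph_mnm f + U_(k1) + U_(q2))%MM ->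
    graph_mnm f z = 0%N) -> ~~ E k1 q1.
  move=> h; apply/negP=> E1; have [q2 ne_q E2] := Edeg _ _ E1.
  have [f pf df] := Epath _ _ E1; have [f' pf' df'] := Epath _ _ E2.
  have ff' := path_eq _ _ pf pf' (avoid _ (h _ _ df)) (avoid _ (h _ _ df')).
  move: df'; rewrite df ff' => /eqP; rewrite eqm_add2l eq_mnm1 => /eqP eq_q.
  by rewrite eq_q eqxx in ne_q.
have no_z q1 : ~~ E z q1.
  apply: no_edge => f q2 df; move: y_z.
  rewrite df !mnmDE !mnm1E eqxx; case: (graph_mnm f z) => // x; lia.
have star k1 q1 : E k1 q1 -> (k1 == k) || (q1 == k).
  move=> E1; apply: contraLR (E1); rewrite negb_or => /andP[ne_p ne_q].
  have ne_kz1 : k1 != z by apply: contraTneq E1 => ->.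
  have ne_qz : q1 != z by apply: contraTneq E1 => ->; rewrite Esym.
  have [f pf df] := Epath _ _ E1.
  have y_z0 : y z = 0%N.
    move: y_k; rewrite df !mnmDE !mnm1E (negPf ne_p) (negPf ne_q) !addn0.
    rewrite {1}dk graph_mnmE; case: eqP => // /(pathU _ pf) nz _.
    rewrite (negPf ne_kz1) (negPf ne_qz) !addn0 graph_mnmE.
    by rewrite -val_eqE /= col_val // (negPf nz).
  apply: no_edge => g q2 dg; move: y_z0; rewrite dg !mnmDE.
  by case: (graph_mnm g z) => // x; lia.
have [k1 E1] : exists k1, E k1 k.
  case/orP: (star _ _ Epq) => /eqP dpq; last by exists p; rewrite -dpq.
  by exists q; rewrite Esym -dpq.
have ne_k1 : k1 != k by apply: contraTneq E1 => ->; rewrite Eirr.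
have [q2 ne_q2 /star] := Edeg _ _ E1.
by rewrite (negPf ne_k1) (negPf ne_q2).
Qed.

End Grid.

Theorem proposition3p5 (K : fieldType) (m n : nat)
    (hm : (3 <= m)%N) (hn : (3 <= n)%N)
    (F : free_complex {mpoly K[nvars 'I_m n]})
    (a : forall t : nat, 'I_(fc_rank F t) -> 'X_{1..nvars 'I_m n})
    (hF : is_min_multigraded_resolution a (Lideal K 'I_m n)) :
  ~ has_linear_resolution (HS a 2).
Proof.
case: m hm F a hF => [|[|[|m]]] // _; case: n hn => [|[|[|n]]] // _ F a hF.
have [ju dju] := hook_shift hF (fun i _ => @isotone_spike_last m n i).
have [jv djv] := hook_shift hF (@isotone_spike_first m n).
apply: (@linear_resolution_linkage _ _ _ (a 2) m.+3.+2 _ _ _ _ _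
          (mdeg_hook ord_max (inord 0)) (mdeg_hook ord0 (inord 2))).
- move=> j; have := shift_deg hF (@Lideal_deg m n K) (t := 2) j.
  by rewrite addn2.
- by apply: ideal_gen_mulX (lepm_refl _); exists ju; rewrite dju.
- by apply: ideal_gen_mulX (lepm_refl _); exists jv; rewrite djv.
(* The path u contains the cell in row 1, column 0, and v does not. *)
- apply/eqP=> /mnmP/(_ (cell (inord 1) (inord 0))); rewrite !hookE.
  by rewrite -!val_eqE /= !inordK.
by move=> k j lt_k dj le_j; apply: (shift_near_hook hF dj lt_k).
Qed.
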